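(* For any graph $G$, $$\frac{\alpha_{\mathrm{bnr}}(G)}{\Gamma_b(G)}\le\frac{\alpha_{\mathrm{bn}}(G)}{\Gamma_b(G)}<2.$$ The bound for $\alpha_{\mathrm{bn}}(G)/\Gamma_b(G)$ is asymptotically best possible, i.e., there is a sequence of graphs $(S_k)$ with $\lim_{k\to\infty}\alpha_{\mathrm{bn}}(S_k)/\Gamma_b(S_k)=2$.
   Context: All graphs are finite and simple. Let $d(u,v)$ denote distance and $e(v)$ the eccentricity of $v$. A broadcast on a connected graph $G=(V,E)$ is a function $f:V\to\{0,1,\dots,\operatorname{diam}(G)\}$ with $f(v)\le e(v)$ for all $v\in V$ if $|V|\ge 2$, and $f(v)=1$ if $V=\{v\}$. On a disconnected graph, a broadcast is a union of broadcasts on its components. Let $V_f^+=\{v: f(v)>0\}$ and $\sigma(f)=\sum_{v\in V}f(v)$ (the weight). A vertex $u$ hears $f$ from $v\in V_f^+$ (and $v$ dominates $u$) if $d(u,v)\le f(v)$. $f$ is dominating if every vertex hears $f$ from some vertex of $V_f^+$. A dominating broadcast $f$ is minimal dominating if no broadcast $g\neq f$ with $g(v)\le f(v)$ for all $v$ is dominating. $\Gamma_b(G)$ is the maximum weight of a minimal dominating broadcast of $G$. For $v\in V_f^+$ let $N_f(v)=\{u:d(u,v)\le f(v)\}$, $B_f(v)=\{u:d(u,v)=f(v)\}$, and let the private boundary $\operatorname{PB}_f(v)$ be the set of $u\in N_f(v)$ that are not dominated by the function obtained from $f$ by changing the value at $v$ to $f(v)-1$. $f$ is irredundant if $\operatorname{PB}_f(v)\ne\varnothing$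 for each $v\in V_f^+$. $f$ is bn-independent if $N_f(u)\cap N_f(v)\subseteq B_f(u)\cap B_f(v)$ for all distinct $u,v\in V_f^+$; it is bnr-independent if it is bn-independent and irredundant. $\alpha_{\mathrm{bn}}(G)$ and $\alpha_{\mathrm{bnr}}(G)$ are the maximum weights of a bn-independent and a bnr-independent broadcast on $G$, respectively. *)

(* Defs.v *)
From mathcomp Require Import all_boot.

Set Implicit Arguments.
Unset Strict Implicit.
Unset Printing Implicit Defensive.

(* The null graph is excluded: all its parameters are 0, so that the ratios
   would be 0 / 0. *)
Record sgraph := SGraph {
  vertex :> finType;
  adj : rel vertex;
  adj_sym : symmetric adj;
  adj_irr : irreflexive adj;
  vertex_gt0 : 0 < #|vertex|
}.

Section Broadcasts.
Variable G : sgraph.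
Implicit Types (u v : G) (f : G -> nat).

Definition component v : {set G} := [set u | connect (@adj G) v u].

(* The least length of a walk from u to v; a shortest walk has fewer than #|G|
   edges. The default value #|G| is taken between different components, where
   the distance is infinite; every use below is restricted to a component. *)
Definition dist u v : nat :=
  find (fun n => [exists p : n.-tuple G, path (@adj G) u p && (last u p == v)])
       (iota 0 #|G|).

Definition ecc v : nat := \max_(u in component v) dist u v.

(* The codomain {0, ..., diam} needs no separate clause, since ecc v is at most
   the diameter of the component of v. *)
Definition broadcast f : bool :=
  [forall v, if component v == [set v] then f v == 1 else f v <= ecc v].

Definition weight f : nat := \sum_(v : G) f v.

Definition nbhd f v : {set G} := [set u in component v | dist u v <= f v].

Definition bdry f v : {set G} := [set u in component v | dist u v == f v].

Definition hears f u v : bool := (0 < f v) && (u \in nbhd f v).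

Definition dominated f u : bool := [exists v, hears f u v].

Definition dominating f : bool := [forall u, dominated f u].

Definition decr f v : G -> nat := fun w => if w == v then (f v).-1 else f w.

Definition private_bdry f v : {set G} :=
  [set u in nbhd f v | ~~ dominated (decr f v) u].

Definition irredundant f : bool :=
  [forall v, (0 < f v) ==> (private_bdry f v != set0)].

Definition bn_independent f : bool :=
  [forall u, forall v, [&& 0 < f u, 0 < f v & u != v] ==>
    (nbhd f u :&: nbhd f v \subset bdry f u :&: bdry f v)].

Definition bnr_independent f : bool := bn_independent f && irredundant f.

(* A finite type of functions containing every broadcast, by broadcast_le. *)
Definition bfun : finType := {ffun G -> 'I_#|G|.+1}.

Definition bval (h : bfun) : G -> nat := fun v => h v.

Definition minimal_dominating f : bool :=
  [&& broadcast f, dominating f &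
    ~~ [exists h : bfun, let g := bval h in
          [&& broadcast g, [exists v, g v != f v], [forall v, g v <= f v]
            & dominating g]]].

Definition Gamma_b : nat :=
  \max_(h : bfun | minimal_dominating (bval h)) weight (bval h).

Definition alpha_bn : nat :=
  \max_(h : bfun | broadcast (bval h) && bn_independent (bval h))
     weight (bval h).

Definition alpha_bnr : nat :=
  \max_(h : bfun | broadcast (bval h) && bnr_independent (bval h))
     weight (bval h).

Lemma broadcast_le f v : broadcast f -> f v <= #|G|.
Proof.
move=> /forallP/(_ v); case: ifP => _ => [/eqP->|/leq_trans]; first exact: vertex_gt0.
apply; apply/bigmax_leqP => u _.
by rewrite -[leqRHS](size_iota 0) find_size.
Qed.

Lemma bfun_surj f : broadcast f -> exists h : bfun, bval h =1 f.
Proof.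
move=> bf; exists [ffun v => inord (f v)] => v.
by rewrite /bval ffunE inordK // ltnS broadcast_le.
Qed.

Lemma dist_self v : dist v v = 0.
Proof.
rewrite /dist; move: (vertex_gt0 G); case: #|G| => // n _ /=.
by case: existsP => // -[]; exists [tuple]; rewrite /= eqxx.
Qed.

Lemma dist_gt0 u v : u != v -> 0 < dist u v.
Proof.
move=> uv; rewrite /dist; move: (vertex_gt0 G); case: #|G| => // n _ /=.
by case: existsP => // -[p]; rewrite tuple0 /= (negbTE uv).
Qed.

Lemma Gamma_b_gt0 : 0 < Gamma_b.
Proof.
pose P (h : bfun) := broadcast (bval h) && dominating (bval h).
have b1 : broadcast (fun=> 1).
  apply/forallP => v; case: ifPn => // cv.
  have vv : v \in component v by rewrite inE.
  have [u uc uv] : exists2 u, u \in component v & u != v.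
    apply/exists_inP; apply: contraR cv => /exists_inPn cv.
    by apply/eqP/setP => u; rewrite in_set1; apply/idP/eqP => [/cv/negPn/eqP|->].
  by apply: leq_trans (dist_gt0 uv) _; rewrite /ecc (bigD1 u) //= leq_maxl.
have [h0 h0E] := bfun_surj b1.
have Ph0 : P h0.
  rewrite /P; apply/andP; split.
    by apply/forallP => v; rewrite h0E; move/forallP: b1; apply.
  apply/forallP => v; apply/existsP; exists v.
  by rewrite /hears /nbhd !inE h0E dist_self connect0.
case: (arg_minnP (fun h => weight (bval h)) Ph0) => h /andP[bh dh] minh.
have mh : minimal_dominating (bval h).
  rewrite /minimal_dominating bh dh /=; apply/existsPn => g; apply/negP.
  case/and4P => bg /existsP[v gv] /forallP gh dg.
  have := minh g; rewrite /P bg dg => /(_ isT); apply/negP; rewrite -ltnNge.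
  rewrite /weight (bigD1 v) //= [ltnRHS](bigD1 v) //= -addSn leq_add //.
    by rewrite ltn_neqAle gv gh.
  by apply: leq_sum => w _; apply: gh.
rewrite /Gamma_b (bigD1 h) //=; apply: leq_trans (leq_maxl _ _).
have /card_gt0P[u _] := vertex_gt0 G.
have /forallP/(_ u)/existsP[v /andP[fv _]] := dh.
by rewrite /weight (bigD1 v) //= ltn_addr.
Qed.

End Broadcasts.

(* Main.v *)
Require Import Defs.
From mathcomp Require Import all_boot all_order all_algebra.
From mathcomp Require Import all_classical all_reals all_analysis.
From mathcomp Require Import zify lra.

Set Implicit Arguments.
Unset Strict Implicit.
Unset Printing Implicit Defensive.

Import Order.TTheory GRing.Theory Num.Theory.
Import numFieldNormedType.Exports.

(** The strict bound comes from independent sets, since the indicator of a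
    maximal independent set is a minimal dominating broadcast, so that
    [Gamma_b] is at least the independence number
    ([independent_le_Gamma_b]). Let [f] be a bn-independent broadcast. Balls
    meeting only in their boundaries means that two broadcasting vertices
    [v] and [w] in the same component are at distance at least [f v + f w].
    Hence vertices at distances [0, 2, 4, ...] below [f v] from [v], taken for
    all broadcasting [v] together, form an independent set: the triangle
    inequality separates those of different centres by at least 2, and those
    of the same centre already differ by 2 in their distance to it. This gives
    at least half of the weight of [f], and more than half when some value is
    odd. When all values are even, one further vertex, on the boundary of one
    ball, can be added ([weight_lt_double_independent]).

    For sharpness, take the spider with [m] legs of length 2. The value 2 on
    every tip is bn-independent, of weight [2 m]: the balls of radius 2 around
    the tips meet only in the centre. On the other hand [Gamma_b] is at most
    [m + 4]. In a minimal dominating broadcast [f] let [y] reach furthest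
    beyond the centre; every vertex that hears another [x] through the centre
    hears [y] too, so the private boundary of [x] lies in the leg of [x]. This
    forces [f x = 1] and leaves room for one such [x] per leg, while
    [f y] is at most 4 ([spider_Gamma_b_le]). The ratio is thus between
    [2 m / (m + 4)] and 2. *)

(** * Distance *)

Section Distance.
Variable G : sgraph.
Implicit Types u v w : G.

Lemma dist_le_path u p : path (@adj G) u p -> dist u (last u p) <= size p.
Proof.
move=> up; rewrite /dist; set a := (X in find X).
have [pG|Gp] := ltnP (size p) #|G|; last first.
  by apply: leq_trans Gp; rewrite -[leqRHS](size_iota 0) find_size.
rewrite leqNgt; apply/negP => /(before_find 0).
rewrite nth_iota // add0n => /negbT/negP; apply.
by apply/existsP; exists (in_tuple p); rewrite /= up eqxx.
Qed.

Lemma geodesic u v : connect (@adj G) u v ->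
  exists p, [/\ path (@adj G) u p, last u p = v & size p = dist u v].
Proof.
move=> /connectP[q /shortenP[p up /card_uniqP /= pG _] vE].
have /(nth_find 0) : has (fun n => [exists p : n.-tuple G,
    path (@adj G) u p && (last u p == v)]) (iota 0 #|G|).
  apply/hasP; exists (size p).
    by rewrite mem_iota /= add0n -pG; apply: max_card.
  by apply/existsP; exists (in_tuple p); rewrite /= up vE eqxx.
rewrite -/(dist u v) nth_iota; last first.
  rewrite vE (leq_ltn_trans (dist_le_path up)) // -pG; exact: max_card.
rewrite add0n => /existsP[t /andP[ut /eqP tv]].
by exists t; rewrite size_tuple.
Qed.

Lemma dist_triangle u v w : connect (@adj G) u v -> connect (@adj G) v w ->
  dist u w <= dist u v + dist v w.
Proof.
move=> /geodesic[p [up pv <-]] /geodesic[q [vq qw <-]].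
have := @dist_le_path u (p ++ q).
by rewrite cat_path last_cat pv up vq qw size_cat; apply.
Qed.

Lemma connect_adj_sym : connect_sym (@adj G).
Proof. exact: sym_connect_sym (@adj_sym G). Qed.

Lemma distC u v : connect (@adj G) u v -> dist u v = dist v u.
Proof.
have le x y : connect (@adj G) x y -> dist y x <= dist x y.
  move=> /geodesic[p [xp py <-]].
  have := @dist_le_path y (rev (belast x p)).
  rewrite size_rev size_belast -{1}py rev_path.
  have -> : last y (rev (belast x p)) = x.
    by case: p {xp} py => [<-|z p _] //=; rewrite rev_cons last_rcons.
  by apply; rewrite (eq_path (e' := @adj G)) // => a b; apply: adj_sym.
by move=> uv; apply/eqP; rewrite eqn_leq !le // connect_adj_sym.
Qed.

Lemma dist_adj u v : adj u v -> dist u v <= 1.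
Proof. by move=> uv; apply: (@dist_le_path u [:: v]); rewrite /= uv. Qed.

(** A geodesic from [u] to [v] passes through every distance from [v]. *)
Lemma dist_between u v i : connect (@adj G) u v -> i <= dist u v ->
  exists x, [/\ connect (@adj G) u x, connect (@adj G) x v, dist x v = i
    & dist u x + i <= dist u v].
Proof.
have [n] := ubnP (dist u v); elim: n u => // n IH u dn uv.
rewrite leq_eqVlt => /predU1P[->|iu].
  by exists u; rewrite connect0 dist_self.
have [[|w p] /= [up lp sp]] := geodesic uv; first by rewrite -sp in iu.
have /andP[uw wp] := up.
have wv : connect (@adj G) w v by apply/connectP; exists p.
have dwp : dist w v <= size p by rewrite -lp; apply: dist_le_path.
have [||x [wx xv xi dwx]] := IH w _ wv; try lia.
  have := dist_triangle (connect1 uw) wv; have := dist_adj uw; lia.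
exists x; split=> //; first exact: connect_trans (connect1 uw) wx.
have := dist_triangle (connect1 uw) wx; have := dist_adj uw.
lia.
Qed.

(** Along a path to [v] the value [D _ v] ends at 0 and drops by at most 1 per
    edge, so [D] is at most the distance; descending by 1 at each step gives a
    path of length [D u v]. *)
Lemma dist_unique (D : G -> G -> nat) :
  (forall u, D u u = 0) ->
  (forall u w v, adj u w -> D u v <= (D w v).+1) ->
  (forall u v, u != v -> exists2 w, adj u w & D u v = (D w v).+1) ->
  forall u v, connect (@adj G) u v /\ dist u v = D u v.
Proof.
move=> D0 Dlip Ddesc u v.
have up_path : exists p, [/\ path (@adj G) u p, last u p = v & size p = D u v].
  have [n] := ubnP (D u v); elim: n u => // n IH u Dn.
  have [->|/Ddesc[w uw Dw]] := eqVneq u v; first by exists [::]; rewrite D0.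
  have [|p [wp pv sp]] := IH w; first by rewrite -ltnS -Dw.
  by exists (w :: p); rewrite /= uw sp.
have low p : path (@adj G) u p -> last u p = v -> D u v <= size p.
  elim: p u {up_path} => [|w p IH] u /= => [_ ->|/andP[uw wp] pv].
    by rewrite D0.
  by apply: leq_trans (Dlip _ _ _ uw) _; apply: IH.
have [p [up pv sp]] := up_path.
have uv : connect (@adj G) u v by apply/connectP; exists p.
split=> //; apply/eqP; rewrite eqn_leq -{1}sp -{1}pv dist_le_path //=.
by have [q [uq qv <-]] := geodesic uv; apply: low.
Qed.

End Distance.

(** * Independent sets and the upper broadcast number *)

Section Independent.
Variable G : sgraph.
Implicit Types (A I : {set G}) (f : G -> nat).

Definition independent A : bool :=
  [forall u in A, forall v in A, ~~ adj u v].

Lemma bfun_of f : broadcast f -> exists h : bfun G, bval h = f.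
Proof. by move=> /bfun_surj[h hE]; exists h; apply/funext. Qed.

Lemma alpha_bn_ge f :
  broadcast f -> bn_independent f -> weight f <= alpha_bn G.
Proof.
move=> bf nf; have [h hE] := bfun_of bf.
by rewrite -hE /alpha_bn (bigD1 h) /= ?leq_maxl // hE bf.
Qed.

Lemma Gamma_b_ge f : minimal_dominating f -> weight f <= Gamma_b G.
Proof.
move=> mf; have /and3P[bf _ _] := mf; have [h hE] := bfun_of bf.
by rewrite -hE /Gamma_b (bigD1 h) /= ?leq_maxl // hE.
Qed.

Lemma mem_component (u v : G) : (u \in component v) = connect (@adj G) v u.
Proof. by rewrite inE. Qed.

Lemma ecc_ge (u v : G) : connect (@adj G) v u -> dist u v <= ecc v.
Proof.
by move=> vu; rewrite /ecc (bigD1 u) ?mem_component //= leq_maxl.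
Qed.

Lemma ecc_attained (v : G) :
  exists2 u, connect (@adj G) v u & dist u v = ecc v.
Proof.
have v0 : v \in component v by rewrite inE.
rewrite /ecc (bigop.bigmax_eq_arg v) //.
by case: arg_maxnP => // u; rewrite mem_component => vu _; exists u.
Qed.

Lemma ecc_gt0 (v : G) : component v != [set v] -> 0 < ecc v.
Proof.
move=> cv.
have [u vu uv] : exists2 u, u \in component v & u != v.
  apply/exists_inP; apply: contraR cv => /exists_inPn cv.
  apply/eqP/setP => u; rewrite finset.in_set1.
  by apply/idP/eqP => [/cv/negPn/eqP|->]; rewrite ?inE.
by apply: leq_trans (dist_gt0 uv) (ecc_ge _); rewrite -mem_component.
Qed.

(** The indicator of a maximal independent set dominates by maximality, and a
    vertex of the set hears no other vertex of the set, so that no value can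
    be lowered. *)
Lemma maxset_independent_minimal_dominating I :
  maxset independent I -> minimal_dominating (fun v => (v \in I : nat)).
Proof.
move=> /maxsetP[/forall_inP indI maxI].
have indIP u v : u \in I -> v \in I -> ~~ adj u v.
  by move=> /indI /forall_inP; apply.
have nbr u : u \notin I -> exists2 v, v \in I & adj v u.
  move=> uI; apply/exists_inP; apply: contraR uI => /exists_inPn uI.
  rewrite -(maxI (u |: I)) ?finset.setU11 ?finset.subsetUr //.
  apply/forall_inP => a; rewrite finset.in_setU1 => aI.
  apply/forall_inP => b; rewrite finset.in_setU1 => bI.
  case/predU1P: aI => [->|aI]; case/predU1P: bI => [->|bI].
  - by rewrite adj_irr.
  - by rewrite adj_sym uI.
  - by rewrite uI.
  - exact: indIP.
apply/and3P; split.
- apply/forallP => v; case: ifPn => [/eqP cv|/ecc_gt0]; last by case: (v \in I).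
  rewrite eqb1; apply: contraT => /nbr[u _ uv].
  have : u \in component v by rewrite inE connect1 // adj_sym.
  by rewrite cv inE => /eqP vu; rewrite vu adj_irr in uv.
- apply/forallP => v; apply/existsP.
  have [vI|/nbr[u uI uv]] := boolP (v \in I).
    by exists v; rewrite /hears vI !inE connect0 dist_self.
  exists u; rewrite /hears !inE uI connect1 //=.
  by apply: dist_adj; rewrite adj_sym.
- apply/existsPn => h; apply/negP => /= /and4P[_ /existsP[v vI] /forallP leI].
  move=> /forallP/(_ v)/existsP[u /andP[u0]]; rewrite !inE => /andP[uv duv].
  have vin : v \in I by move: vI (leI v); case: (v \in I) => //; case: (bval h v).
  have uin : u \in I by move: (leI u); case: (u \in I) u0 => //; case: (bval h u).
  have huv : u != v.
    by apply: contraNneq vI => uv'; move: (leI v) u0; rewrite uv' vin; lia.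
  have du1 : dist v u <= 1 by apply: leq_trans duv _; have := leI u; rewrite uin.
  rewrite connect_adj_sym in uv.
  have [[|w [|? ?]] [/= vp lp sp]] := geodesic uv; rewrite -?sp // in du1.
    by rewrite lp eqxx in huv.
  by move: vp; rewrite lp andbT (negbTE (indIP _ _ vin uin)).
Qed.

Lemma independent_le_Gamma_b I : independent I -> #|I| <= Gamma_b G.
Proof.
move=> /maxset_exists[J maxJ IJ].
apply: leq_trans (Gamma_b_ge (maxset_independent_minimal_dominating maxJ)).
rewrite /weight -sum1_card big_mkcond; apply: leq_sum => v _.
by case: ifP => // /(fintype.subsetP IJ) ->.
Qed.

End Independent.

(** Where lowering [f x] by one yields a broadcast, minimality makes some vertex
    lose its only source. At an isolated vertex, where the value 1 is imposed
    and lowering it does not give a broadcast, the vertex itself is private. *)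
Lemma minimal_dominating_irredundant (G : sgraph) (f : G -> nat) :
  minimal_dominating f -> irredundant f.
Proof.
move=> /and3P[/forallP bf /forallP df /existsPn minf].
apply/forallP => x; apply/implyP => fx; apply/finset.set0Pn.
have [cx|cx] := eqVneq (component x) [set x].
  exists x; rewrite !inE connect0 dist_self /=; apply/existsPn => y.
  apply/negP => /andP[dy]; rewrite !inE connect_adj_sym => /andP[xy _].
  have : y \in component x by rewrite inE.
  rewrite cx inE => /eqP yx; move: dy; rewrite yx /decr eqxx.
  by have := bf x; rewrite cx eqxx => /eqP ->.
have dle v : decr f x v <= f v.
  by rewrite /decr; case: eqP => // ->; apply: leq_pred.
have bd : broadcast (decr f x).
  apply/forallP => v; have := bf v; case: ifPn => [cv|_]; last first.
    exact: leq_trans.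
  by rewrite /decr ifN //; apply: contraNneq cx => <-.
have [h hE] := bfun_of bd.
have := minf h; rewrite /= hE bd /= !negb_and.
have -> : [exists v, decr f x v != f v].
  by apply/existsP; exists x; rewrite /decr eqxx; lia.
have -> : [forall v, decr f x v <= f v] by apply/forallP.
move=> /= /forallPn[p np]; exists p; rewrite inE np andbT.
have /existsP[y /andP[fy py]] := df p.
have [<-//|yx] := eqVneq y x.
case/negP: np; apply/existsP; exists y.
by move: py; rewrite /hears !inE /decr (negbTE yx) fy.
Qed.

(** * Independent sets from boundary independent broadcasts *)

Section BoundaryIndependent.
Variables (G : sgraph) (f : G -> nat).
Hypotheses (bf : broadcast f) (nf : bn_independent f).

(** Otherwise the vertex of a geodesic at distance [minn (f v) (dist w v)] from
    [v] lies in both balls, and in the interior of the ball around [w]. *)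
Lemma bn_independent_dist v w : v != w -> 0 < f v -> 0 < f w ->
  connect (@adj G) w v -> f v + f w <= dist w v.
Proof.
move=> vw fv fw cwv; rewrite leqNgt; apply/negP => dwv.
have [x [wx xv xi dwx]] := dist_between cwv (geq_minr (f v) (dist w v)).
move/forallP/(_ v)/forallP/(_ w): nf; rewrite fv fw vw /=.
move=> /fintype.subsetP/(_ x); rewrite !inE wx (connect_adj_sym v) xv xi.
rewrite geq_minl /=; rewrite (distC (u := x)) 1?connect_adj_sym //.
have /[swap]/[apply] : dist w x <= f w by lia.
by move=> /andP[_ /eqP]; lia.
Qed.

Lemma not_adj_spread v w x y : v != w -> 0 < f v -> 0 < f w ->
  connect (@adj G) v x -> connect (@adj G) w y ->
  dist x v + dist y w + 2 <= f v + f w -> x != y /\ ~~ adj x y.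
Proof.
move=> vw fv fw vx wy dxy.
suff far : connect (@adj G) y x -> 2 <= dist y x.
  split; apply/negP.
    by move=> /eqP xy; have := far; rewrite xy dist_self connect0 => /(_ isT).
  by rewrite adj_sym => yx; have := far (connect1 yx); have := dist_adj yx; lia.
move=> yx; have xv : connect (@adj G) x v by rewrite connect_adj_sym.
have wx := connect_trans wy yx.
have := bn_independent_dist vw fv fw (connect_trans wx xv).
have := dist_triangle wx xv; have := dist_triangle wy yx.
by rewrite (distC wy); lia.
Qed.

Lemma not_adj_same_center v x y : connect (@adj G) v x ->
  connect (@adj G) v y -> dist x v + 2 <= dist y v -> x != y /\ ~~ adj x y.
Proof.
move=> vx vy dxy; split; apply/negP.
  by move=> /eqP xy; rewrite xy in dxy; lia.
rewrite connect_adj_sym in vx; rewrite adj_sym => xy.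
by have := dist_triangle (connect1 xy) vx; have := dist_adj xy; lia.
Qed.

(** Since [f v <= ecc v], every distance up to [f v] occurs, except at an
    isolated vertex, where [f v = 1] but only the distance 0 occurs. For even
    distances the exception disappears. *)
Lemma broadcast_sphere v i : i.*2 <= f v ->
  exists x, connect (@adj G) v x && (dist x v == i.*2).
Proof.
case: i => [|i] iv; first by exists v; rewrite connect0 dist_self.
have /forallP/(_ v) := bf; case: ifP => [_ /eqP fv|_ fv]; first by lia.
have [u vu du] := ecc_attained v.
have [||x [_ xv xi _]] := @dist_between G u v i.+1.*2.
- by rewrite connect_adj_sym.
- by rewrite du (leq_trans iv).
by exists x; rewrite connect_adj_sym xv xi eqxx.
Qed.

(** Around each [v] take one vertex at each distance [0, 2, ..., 2 (n v - 1)].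
    Two of them around the same [v] differ by at least 2 in their distance to
    [v]; around different centres they are kept apart by the distance
    [f v + f w] of the centres. *)
Lemma exists_independent_spread (n : G -> nat) :
  (forall v, f v = 0 -> n v = 0) -> (forall v, (n v).*2 <= f v + 2) ->
  (forall v w, v != w -> 0 < f v -> 0 < f w ->
     (n v).*2 + (n w).*2 <= f v + f w + 2) ->
  exists2 I : {set G}, independent I & #|I| = \sum_v n v.
Proof.
move=> n0 n1 n2.
pose T := {v : G & 'I_(n v)}.
pose ctr (t : T) : G := tag t; pose idx (t : T) : nat := tagged t.
have idx_lt t : idx t < n (ctr t) by case: t => v i; apply: ltn_ord.
have idx_inj s t : ctr s = ctr t -> idx s = idx t -> s = t.
  case: s t => [v i] [w j]; rewrite /ctr /idx /= => vw.
  by case: w / vw j => j /val_inj ->.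
have X_ex t :
    exists x, connect (@adj G) (ctr t) x && (dist x (ctr t) == (idx t).*2).
  by apply: broadcast_sphere; have := n1 (ctr t); have := idx_lt t; lia.
pose X t := xchoose (X_ex t).
have XP t : connect (@adj G) (ctr t) (X t) /\ dist (X t) (ctr t) = (idx t).*2.
  by have /andP[? /eqP] := xchooseP (X_ex t).
have fpos t : 0 < f (ctr t).
  by rewrite lt0n; apply/negP => /eqP/n0; have := idx_lt t; lia.
have sep s t : s != t -> X s != X t /\ ~~ adj (X s) (X t).
  have [vs ds] := XP s; have [vt dt] := XP t => st.
  have [vw|vw] := eqVneq (ctr s) (ctr t); last first.
    apply: (not_adj_spread vw) => //; rewrite ds dt.
    have := n2 _ _ vw (fpos s) (fpos t).
    by have := idx_lt s; have := idx_lt t; lia.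
  have /eqP ij : idx s != idx t by apply: contraNneq st => /(idx_inj _ _ vw) ->.
  rewrite -vw in vt dt.
  have /orP[lt|lt] : (idx s < idx t)%N || (idx t < idx s)%N by lia.
    by apply: (not_adj_same_center vs vt); rewrite ds dt; lia.
  rewrite eq_sym adj_sym.
  by apply: (not_adj_same_center vt vs); rewrite ds dt; lia.
have Xinj : injective X.
  by move=> s t st; apply/eqP; apply: contraTT isT => /sep[]; rewrite st eqxx.
exists [set X t | t : T].
  apply/forall_inP => _ /imsetP[s _ ->]; apply/forall_inP => _ /imsetP[t _ ->].
  by have [->|/sep[]//] := eqVneq s t; rewrite adj_irr.
rewrite card_imset // card_tagged sumnE big_map big_enum /=.
by apply: eq_bigr => v _; rewrite card_ord.
Qed.

(** Taking the distances below [f v] yields [uphalf (f v)] vertices around [v],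
    which is more than half as soon as some value is odd. If all values are
    even, these vertices stay strictly inside the balls, which leaves room for
    a boundary vertex of one of them. *)
Lemma weight_lt_double_independent : 0 < weight f ->
  exists2 I : {set G}, independent I & weight f < #|I|.*2.
Proof.
rewrite /weight => f0.
have [/existsP[z odd_z]|/existsPn even] := boolP [exists v, odd (f v)].
  have [| | |I indI cI] := @exists_independent_spread (fun v => uphalf (f v)).
  - by move=> v ->.
  - by move=> v; lia.
  - by move=> v w *; lia.
  exists I => //; rewrite cI (bigD1 z) //= [X in (_ < X.*2)%N](bigD1 z) //=.
  suff : (\sum_(v | v != z) f v <= (\sum_(v | v != z) uphalf (f v)).*2)%N.
    by lia.
  by rewrite -mul2n big_distrr /=; apply: leq_sum => v _; lia.
have [z fz] : exists z, 0 < f z.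
  apply/existsP; apply: contraTT f0 => /existsPn f0.
  by rewrite -leqNgt leqn0 sum_nat_eq0; apply/forallP => v; have := f0 v; lia.
have [| | |I indI cI] :=
  @exists_independent_spread (fun v => (f v)./2 + (v == z)).
- by move=> v fv; rewrite fv; case: eqP => // vz; rewrite -vz fv in fz.
- by move=> v /=; lia.
- move=> v w vw fv fw /=.
  have : ~~ ((v == z) && (w == z)).
    by apply: contraNN vw => /andP[/eqP -> /eqP ->].
  have := even v; have := even w; lia.
exists I => //; rewrite cI (bigD1 z) //= [X in (_ < X.*2)%N](bigD1 z) //= eqxx.
suff : (\sum_(v | v != z) f v <= (\sum_(v | v != z) ((f v)./2 + (v == z))).*2)%N.
  by have := even z; lia.
by rewrite -mul2n big_distrr /=; apply: leq_sum => v _; have := even v; lia.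
Qed.

Lemma weight_lt_double_Gamma_b : weight f < (Gamma_b G).*2.
Proof.
have [|f0] := posnP (weight f); first by have := Gamma_b_gt0 G; lia.
have [I /independent_le_Gamma_b] := weight_lt_double_independent f0.
lia.
Qed.

End BoundaryIndependent.

Lemma alpha_bn_lt (G : sgraph) : alpha_bn G < (Gamma_b G).*2.
Proof.
have := Gamma_b_gt0 G => G0.
rewrite /alpha_bn -[X in _ < X]prednK; last lia.
by rewrite ltnS; apply/bigop.bigmax_leqP => h /andP[bh nh];
   have := weight_lt_double_Gamma_b bh nh; lia.
Qed.

Lemma alpha_bnr_le (G : sgraph) : alpha_bnr G <= alpha_bn G.
Proof.
apply/bigop.bigmax_leqP => h /and3P[bh nh _].
exact: alpha_bn_ge.
Qed.

(** * Spiders with legs of length 2 *)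

Section Spider.
Variable m : nat.

(** [None] is the centre, [Some (i, false)] and [Some (i, true)] are the inner
    vertex and the tip of leg [i]. *)
Definition spider_vertex : finType := option ('I_m * bool).
Implicit Types u v w x y : spider_vertex.

Definition height v : nat := if v is Some (_, tip) then tip.+1 else 0.

Definition same_leg u v : bool :=
  match u, v with Some (i, _), Some (j, _) => i == j | _, _ => false end.

Definition spider_dist u v : nat :=
  if same_leg u v then (height u != height v : nat) else height u + height v.

Definition spider_adj u v : bool := spider_dist u v == 1.

Lemma spider_distC u v : spider_dist u v = spider_dist v u.
Proof.
case: u v => [[i a]|] [[j b]|]; rewrite /spider_dist /= ?addn0 //.
by rewrite eq_sym (eq_sym (_.+1)) addnC.
Qed.

Lemma spider_dist_self u : spider_dist u u = 0.
Proof. by case: u => [[i a]|]; rewrite /spider_dist /= ?eqxx. Qed.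

Lemma spider_adj_sym : symmetric spider_adj.
Proof. by move=> u v; rewrite /spider_adj spider_distC. Qed.

Lemma spider_adj_irr : irreflexive spider_adj.
Proof. by move=> u; rewrite /spider_adj spider_dist_self. Qed.

Lemma spider_gt0 : 0 < #|spider_vertex|.
Proof. by apply/card_gt0P; exists None. Qed.

Definition spider : sgraph := SGraph spider_adj_sym spider_adj_irr spider_gt0.

Lemma spider_metric u v :
  connect (@adj spider) u v /\ @dist spider u v = spider_dist u v.
Proof.
apply: (@dist_unique spider spider_dist) => {u v} [|u w v|u v].
- exact: spider_dist_self.
- rewrite /= /spider_adj /spider_dist.
  by case: u w v => [[i []]|] [[j []]|] [[k []]|] //=;
    do ?[case: (@eqP 'I_m) => ? //=]; congruence.
- (* Each witness is the next vertex on the way from u to v. *)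
  case: u v => [[i a]|] [[j b]|] // uv.
  + have [ij|ij] := eqVneq i j.
      exists (Some (j, b)); rewrite ij in uv *.
        rewrite /= /spider_adj /spider_dist /= eqxx.
        by case: a b uv => [] []; rewrite ?eqxx.
      rewrite spider_dist_self /spider_dist /= eqxx.
      by case: a b uv => [] []; rewrite ?eqxx.
    exists (if a then Some (i, false) else None).
      by rewrite /= /spider_adj /spider_dist; case: a {uv} => /=; rewrite ?eqxx.
    by rewrite /spider_dist; case: a {uv} => /=; rewrite ?(negbTE ij).
  + exists (if a then Some (i, false) else None).
      by rewrite /= /spider_adj /spider_dist; case: a {uv} => /=; rewrite ?eqxx.
    by rewrite /spider_dist; case: a {uv}.
  + exists (Some (j, false)); first by rewrite /= /spider_adj /spider_dist.
    by rewrite /spider_dist /= eqxx; case: b {uv}.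
Qed.

Lemma spider_connect u v : connect (@adj spider) u v.
Proof. by have [] := spider_metric u v. Qed.

Lemma spider_distE u v : @dist spider u v = spider_dist u v.
Proof. by have [] := spider_metric u v. Qed.

Lemma spider_dist_le u v : spider_dist u v <= height u + height v.
Proof.
rewrite /spider_dist; case: ifP => //.
by case: u v => [[i []]|] [[j []]|].
Qed.

Lemma height_le2 u : height u <= 2.
Proof. by case: u => [[i []]|]. Qed.

Lemma spider_ecc_le4 u : @ecc spider u <= 4.
Proof.
apply/bigop.bigmax_leqP => v _; rewrite spider_distE.
apply: leq_trans (spider_dist_le _ _) _.
by have := height_le2 u; have := height_le2 v; lia.
Qed.

Lemma same_leg_dist u v : same_leg u v -> spider_dist u v <= 1.
Proof. by rewrite /spider_dist => ->; case: (_ != _). Qed.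

Lemma spider_component (i0 : 'I_m) u : @component spider u != [set u].
Proof.
apply/eqP => /setP cu.
have := cu None; have := cu (Some (i0, true)).
rewrite !inE !spider_connect; by case: u {cu}.
Qed.

(** Let [y] reach furthest beyond the centre, that is, maximise
    [f y - height y]. A private vertex [p] of another [x] is not heard from
    [y], so the ball around [x] cannot contain [p] by a walk through the
    centre. Hence [x] and [p] share a leg and [f x = 1]; and no second such
    vertex fits into that leg, since it would hear [p]. *)
Lemma spider_Gamma_b_le : 0 < m -> Gamma_b spider <= m + 4.
Proof.
move=> m0; pose i0 : 'I_m := Ordinal m0.
apply/bigop.bigmax_leqP => h; move: (bval h) => f minf {h}.
have [z fz|f0] := pickP (fun x : spider => 0 < f x); last first.
  by rewrite /weight big1 // => x _; have := f0 x; case: (f x).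
(* The summand 2 is at least any height, so that the subtraction does not
   truncate. *)
pose reach (x : spider) := f x + 2 - height x.
case: (@arg_maxnP _ z (fun x => 0 < f x) reach fz) => y fy ymax.
have fy4 : f y <= 4.
  have /and3P[/forallP/(_ y) by_ _ _] := minf.
  rewrite (negbTE (spider_component i0 y)) in by_.
  exact: leq_trans by_ (spider_ecc_le4 y).
have key x : x != y -> 0 < f x -> f x = 1 /\ exists2 p, same_leg p x &
    forall w, w != x -> 0 < f w -> f w < spider_dist p w.
  move=> xy fx.
  have /finset.set0Pn[p] : private_bdry f x != finset.set0.
    by have /forallP/(_ x) := minimal_dominating_irredundant minf; rewrite fx.
  rewrite !inE spider_connect spider_distE => /andP[/= px /existsPn np].
  have np' w : 0 < decr f x w -> decr f x w < spider_dist p w.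
    move=> dw; have := np w.
    by rewrite /hears dw !inE spider_connect spider_distE /= -ltnNge.
  have far w : w != x -> 0 < f w -> f w < spider_dist p w.
    by move=> wx fw; have := np' w; rewrite /decr (negbTE wx); apply.
  have same : same_leg p x.
    apply: contraT => px_leg; move: px; rewrite /spider_dist (negbTE px_leg).
    have := far y; rewrite eq_sym => /(_ xy fy).
    have := spider_dist_le p y; have := ymax x fx; rewrite /reach.
    have := height_le2 x; have := height_le2 y; lia.
  split; last by exists p.
  by have := same_leg_dist same; have := np' x; rewrite /decr eqxx; lia.
pose leg (x : spider) : 'I_m := if x is Some (i, _) then i else i0.
pose A : {set spider} := [set x | (x != y) && (0 < f x)].
have leg_inj : {in A &, injective leg}.
  move=> x x'; rewrite !inE => /andP[xy fx] /andP[xy' fx'] legE.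
  apply/eqP; apply: contraT => xx'.
  have [_ [p px far]] := key x xy fx.
  have [_ [p' px' _]] := key x' xy' fx'.
  have : same_leg p x'.
    case: p p' x x' px px' legE {xy fx xy' fx' xx' far}
      => [[? ?]|] [[? ?]|] // [[? ?]|] [[? ?]|] //.
    by rewrite /leg /= => /eqP -> _ ->.
  move=> /same_leg_dist.
  have := far x'; rewrite eq_sym => /(_ xx' fx'); lia.
have cA : #|A| <= m.
  by rewrite -(card_in_imset leg_inj) -[leqRHS]card_ord max_card.
rewrite /weight (bigD1 y) //= [leqRHS]addnC leq_add //.
apply: leq_trans cA; rewrite -sum1_card big_mkcond [leqRHS]big_mkcond /=.
apply: leq_sum => x _; rewrite inE; case: ifP => //= xy.
by case: posnP => [->//|fx]; have [-> _] := key x xy fx.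
Qed.

(** The value 2 on every tip: the balls of radius 2 meet only in the centre. *)
Lemma spider_alpha_bn_ge : 0 < m -> m.*2 <= alpha_bn spider.
Proof.
move=> m0; pose f (v : spider) : nat := if v is Some (_, true) then 2 else 0.
have f_gt0 v : 0 < f v -> exists i, v = Some (i, true).
  by case: v => [[i []]|] //; exists i.
have fw : m.*2 <= weight f.
  pose tips : {set spider} := [set Some (i, true) | i : 'I_m].
  have ct : #|tips| = m by rewrite card_imset ?card_ord // => i j [].
  rewrite -[in X in X <= _]ct -muln2 -sum_nat_const big_mkcond.
  by apply: leq_sum => v _; case: ifP => // /imsetP[i _ ->].
apply: leq_trans fw (alpha_bn_ge _ _).
  apply/forallP => v; rewrite (negbTE (spider_component (Ordinal m0) v)).
  have [//|/f_gt0[i ->]] := posnP (f v); first by move=> ->.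
  have := @ecc_ge spider None (Some (i, true)) (spider_connect _ _).
  by rewrite spider_distE.
apply/forallP => u; apply/forallP => v; apply/implyP => /and3P[].
move=> /f_gt0[i ->] /f_gt0[j ->] ij.
apply/fintype.subsetP => w.
rewrite !inE !spider_connect !spider_distE /f /spider_dist.
case: w => [[k b]|] //=.
case: (eqVneq k i) => [ki|_]; case: (eqVneq k j) => [kj|_]; try by case: b.
by rewrite -ki -kj eqxx in ij.
Qed.

End Spider.

Local Open Scope classical_set_scope.
Local Open Scope ring_scope.

Theorem theorem5p2 (R : realType) :
  (forall G : sgraph,
     (alpha_bnr G)%:R / (Gamma_b G)%:R <= (alpha_bn G)%:R / (Gamma_b G)%:R :> R
     /\ (alpha_bn G)%:R / (Gamma_b G)%:R < 2 :> R)
  /\ exists S : nat -> sgraph,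
       (alpha_bn (S k))%:R / (Gamma_b (S k))%:R @[k --> \oo] --> (2 : R).
Proof.
have lt2 G : (alpha_bn G)%:R / (Gamma_b G)%:R < 2 :> R.
  rewrite ltr_pdivrMr ?ltr0n ?Gamma_b_gt0 // -natrM ltr_nat mul2n.
  exact: alpha_bn_lt.
split=> [G|]; first split=> //.
  by rewrite ler_wpM2r ?invr_ge0 ?ler0n // ler_nat alpha_bnr_le.
exists (fun k => spider k.+1).
(* With k.+1 legs the ratio is at least 2 (k + 1) / (k + 5) = 2 - 8 / (k + 5),
   hence at least 2 - 8 / (k + 1), a bound by the harmonic sequence. *)
apply: (@squeeze_cvgr _ _ _ _ (fun k => 2 - 8 * harmonic k) (fun=> 2)).
- apply: nearW => k; apply/andP; split; last exact: ltW.
  have G0 : 0 < (Gamma_b (spider k.+1))%:R :> R by rewrite ltr0n Gamma_b_gt0.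
  rewrite ler_pdivlMr //.
  have Gle : (Gamma_b (spider k.+1))%:R <= k%:R + 5 :> R.
    by rewrite -natrD ler_nat (leq_trans (spider_Gamma_b_le _)) // addSnnS.
  have age : 2 * (k%:R + 1) <= (alpha_bn (spider k.+1))%:R :> R.
    by rewrite natr1 -natrM ler_nat mul2n spider_alpha_bn_ge.
  apply: le_trans age.
  have h0 : 0 < harmonic k :> R by exact: harmonic_gt0.
  have hk : harmonic k * (k%:R + 1) = 1 :> R.
    by rewrite /harmonic /= natr1 mulVf // pnatr_eq0.
  move: (harmonic k) (k%:R) (ler0n R k) h0 hk Gle G0 => h n n0 h0 hn Gle G0.
  have [h4|h4] := lerP (8 * h) 2; last by nra.
  by apply: le_trans (ler_wpM2l _ Gle) _; nra.
- rewrite -[X in _ --> X]subr0 -[X in _ - X](mulr0 8).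
  apply: cvgB; first exact: cvg_cst.
  by apply: cvgMr; exact: cvg_harmonic.
- exact: cvg_cst.
Qed.
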